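(* Let $H$ be a graph with an edge $\{u,v\}$ such that $u$ and $v$ have no common neighbor, and let $G$ be the graph obtained from $H$ by contracting $\{u,v\}$ into a new vertex $w$. Let $i\in V(G)$ and suppose $A\in\mathcal{S}(G)$ has the $i$-SNIP. Then there is a matrix $A'\in\mathcal{S}(H)$ such that the $i$-nullity pair of $A'$ equals the $i$-nullity pair of $A$ and $A'$ has the $i$-SNIP; here, if $i\ne w$ then $i$ is the same vertex in $H$, and if $i=w$ then the root $i$ in $H$ can be designated as either $u$ or $v$.
   Context: All matrices are real. Contracting an edge identifies its endpoints and removes loops and multiple edges; vertices of $G$ other than $w$ are identified with the vertices of $H$ other than $u,v$. For a simple graph $G$ with vertices indexed by $[n]$, $\mathcal{S}(G)$ is the set of real symmetric $n\times n$ matrices whose off-diagonal $(j,k)$ entry is nonzero iff $\{j,k\}\in E(G)$ (diagonal free). $A(i)$ is $A$ with row and column $i$ deleted; the $i$-nullity pair of $A$ is $(\operatorname{null}(A),\operatorname{null}(A(i)))$. $A$ has the $i$-SNIP if $X=O$ is the only real symmetric $X$ with $A\circ X=O$, $I\circ X=O$ and $(AX)(i,:]=O$ ($AX$ with row $i$ deleted). *)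

(* Defs.v *)
From HB Require Import structures.
From mathcomp Require Import all_boot all_order all_algebra.
From mathcomp Require Import reals.
Set Implicit Arguments. Unset Strict Implicit. Unset Printing Implicit Defensive.
Import GRing.Theory.
Local Open Scope ring_scope.

Record sgraph (n : nat) := SGraph {
  edge : rel 'I_n;
  edge_sym : symmetric edge;
  edge_irrefl : irreflexive edge }.

(* phi : V(H) -> V(G) is the quotient map. Its only identification is that of
   u with v; away from the fibre over w it is the bijection through which
   V(G) \ {w} and V(H) \ {u, v} are identified. *)
Record is_contraction (m n : nat) (H : sgraph m) (u v : 'I_m)
    (G : sgraph n) (w : 'I_n) (phi : 'I_m -> 'I_n) : Prop := IsContraction {
  contr_edge : edge H u v;
  contr_onto : forall a : 'I_n, exists x : 'I_m, phi x = a;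
  contr_u : phi u = w;
  contr_v : phi v = w;
  contr_fibre_w : forall x : 'I_m, phi x = w -> x = u \/ x = v;
  contr_inj : forall x y : 'I_m, phi x <> w -> phi x = phi y -> x = y;
  contr_adj : forall a b : 'I_n,
    edge G a b <->
    a <> b /\ exists x y : 'I_m, [/\ phi x = a, phi y = b & edge H x y] }.

Definition symmetric_mx (R : realType) (n : nat) (A : 'M[R]_n) : Prop :=
  A^T = A.

Definition in_S (R : realType) (n : nat) (G : sgraph n) (A : 'M[R]_n) : Prop :=
  symmetric_mx A /\
  forall j k : 'I_n, j <> k -> (A j k <> 0 <-> edge G j k).

(* The columns of cokermx A span the null space {x | A *m x = 0}. *)
Definition nullity (R : realType) (n : nat) (A : 'M[R]_n) : nat :=
  \rank (cokermx A).

Definition principal_del (R : realType) (n : nat) (i : 'I_n) (A : 'M[R]_n) :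
  'M[R]_n.-1 := row' i (col' i A).

Definition nullity_pair (R : realType) (n : nat) (i : 'I_n) (A : 'M[R]_n) :
  nat * nat := (nullity A, nullity (principal_del i A)).

Definition hadamard (R : realType) (n : nat) (A B : 'M[R]_n) : 'M[R]_n :=
  \matrix_(j, k) (A j k * B j k).

Definition SNIP (R : realType) (n : nat) (i : 'I_n) (A : 'M[R]_n) : Prop :=
  forall X : 'M[R]_n,
    symmetric_mx X -> hadamard A X = 0 -> hadamard 1%:M X = 0 ->
    row' i (A *m X) = 0 -> X = 0.

(* Main.v *)
From HB Require Import structures.
From mathcomp Require Import all_boot all_order all_algebra.
From mathcomp Require Import boolp classical_sets functions reals.
From mathcomp Require Import interval_inference topology normedtype sequences.
From mathcomp Require Import ring lra.
Require Import Defs.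
Set Implicit Arguments. Unset Strict Implicit. Unset Printing Implicit Defensive.
Import Order.TTheory GRing.Theory Num.Theory.
Import numFieldNormedType.Exports.
Local Open Scope ring_scope.

(** Splitting [w] into [u] and [v] with a huge weight [1 / s] on
    [(x_u - x_v)^2] gives a matrix [A'] which, after eliminating [x_u], is
    congruent to [B (+) (1 / s)], where [B = C - s c^T c], [C] is in S(G) and
    [c] is the part of row [w] of [C] carried by the neighbours of [u].
    It remains to choose [C] near [A] so that [B = (1 + K)^T A (1 + K)] with
    row [i] of [K] zero, since such congruences preserve both nullities.

    The SNIP says that S(G) and the orbit of [A] under these congruences meet
    transversally at [A].  Quantitatively, with [P] the projection killing
    coordinate [i] and [S] the pattern of [G] with its diagonal, the operator
    [X |-> A P A X + X A P A + S o X + X - X^T] is injective, because its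
    quadratic form is a sum of squares vanishing exactly where the SNIP
    applies.  Inverting it and taking [K = P A X], [C = A - S o X], the
    equation for [X] becomes a fixed point problem for a contraction of a small
    ball.  The same inverse bounds the symmetric [Y] to be excluded by
    [small * `|Y|], which gives the SNIP for [A']. *)

(** * Estimates for the max norm of matrices *)

Section MatrixNorm.
Variable R : realType.

Lemma mx_norm_entry m n (X : 'M[R]_(m, n)) i j : `|X i j| <= `|X|.
Proof.
rewrite [`|X|]mx_normrE.
exact: (le_bigmax _ (fun ij : 'I_m * 'I_n => `|X ij.1 ij.2|) (i, j)).
Qed.

Lemma mx_norm_le m n (X : 'M[R]_(m, n)) c :
  0 <= c -> (forall i j, `|X i j| <= c) -> `|X| <= c.
Proof. by move=> c0 Xc; rewrite [`|X|]mx_normrE; apply: bigmax_le. Qed.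

Lemma mx_norm_tr m n (X : 'M[R]_(m, n)) : `|X^T| = `|X|.
Proof.
have le_tr p q (Y : 'M[R]_(p, q)) : `|Y^T| <= `|Y|.
  by apply: mx_norm_le => // i j; rewrite mxE mx_norm_entry.
by apply/eqP; rewrite eq_le le_tr -{1}[X]trmxK le_tr.
Qed.

Lemma mx_norm_mul m n p (X : 'M[R]_(m, n)) (Y : 'M[R]_(n, p)) :
  `|X *m Y| <= n%:R * `|X| * `|Y|.
Proof.
apply: mx_norm_le => [|i j]; first by rewrite !mulr_ge0.
rewrite mxE; apply: le_trans (ler_norm_sum _ _ _) _.
have -> : n%:R * `|X| * `|Y| = \sum_(k < n) `|X| * `|Y|.
  by rewrite sumr_const card_ord mulr_natl -mulrnAl.
apply: ler_sum => k _; rewrite normrM.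
by apply: ler_pM; rewrite ?mx_norm_entry.
Qed.

Lemma linear_mx_bounded m n p q (f : {linear 'M[R]_(m, n) -> 'M[R]_(p, q)}) :
  exists2 k, 0 < k & forall X, `|f X| <= k * `|X|.
Proof.
pose k := \sum_i \sum_j `|f (delta_mx i j)|.
have k0 : 0 <= k by apply: sumr_ge0 => i _; apply: sumr_ge0.
exists (1 + k) => [|X]; first by rewrite ltr_pwDl.
rewrite {1}[X]matrix_sum_delta linear_sum /=.
apply: le_trans (ler_norm_sum _ _ _) _.
apply: (@le_trans _ _ (k * `|X|)); last by rewrite ler_wpM2r ?lerDr.
rewrite mulr_suml; apply: ler_sum => i _.
rewrite linear_sum mulr_suml /=; apply: le_trans (ler_norm_sum _ _ _) _.
apply: ler_sum => j _; rewrite linearZ /= normrZ mulrC.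
by rewrite ler_wpM2l ?mx_norm_entry.
Qed.

Lemma linear_mx_inj_inverse m n (f : {linear 'M[R]_(m, n) -> 'M[R]_(m, n)}) :
  (forall X, f X = 0 -> X = 0) ->
  exists g : {linear 'M[R]_(m, n) -> 'M[R]_(m, n)}, cancel g f /\ cancel f g.
Proof.
move=> f_inj.
have ker0 : lker (linfun f) == 0%VS.
  apply/lker0P => X Y; rewrite !lfunE /= => fXY.
  by apply/subr0_eq/f_inj; rewrite linearB /= fXY subrr.
exists (linfun f)^-1%VF; split=> X.
  by have := lker0_lfunVK ker0 X; rewrite lfunE.
by have := lker0_lfunK ker0 X; rewrite lfunE.
Qed.

(** The factor [|a| + |b|] is what makes a quadratic map a strict contraction on a small enough
    ball. *)
Lemma mx_norm_quadB m n (N : 'M[R]_m) (a b : 'M[R]_(m, n)) :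
  `|a^T *m N *m a - b^T *m N *m b|
    <= m%:R ^+ 2 * `|N| * (`|a| + `|b|) * `|a - b|.
Proof.
have -> : a^T *m N *m a - b^T *m N *m b =
    a^T *m N *m (a - b) + (a - b)^T *m N *m b.
  by rewrite mulmxBr linearB /= !mulmxBl addrA subrK.
apply: le_trans (ler_normD _ _) _.
have bd (c d : 'M[R]_(m, n)) :
    `|c^T *m N *m d| <= m%:R ^+ 2 * `|N| * (`|c| * `|d|).
  apply: le_trans (mx_norm_mul _ _) _.
  apply: (@le_trans _ _ (m%:R * (m%:R * `|c^T| * `|N|) * `|d|)).
    by rewrite ler_wpM2r // ler_wpM2l // mx_norm_mul.
  by rewrite mx_norm_tr le_eqVlt; apply/orP; left; apply/eqP; ring.
have := bd a (a - b); have := bd (a - b) b.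
set x := `|a|; set y := `|b|; set z := `|a - b|; set t := _ * `|N|.
move=> h1 h2; apply: le_trans (lerD h2 h1) _.
by rewrite le_eqVlt; apply/orP; left; apply/eqP; ring.
Qed.

(** A left kernel matrix [Y] satisfies [Y = - Y K], so its norm is at most [n |K| < 1] times
    itself. *)
Lemma unitmx_perturb1 n (K : 'M[R]_n) : n%:R * `|K| < 1 -> 1%:M + K \in unitmx.
Proof.
move=> K1; rewrite -row_free_unit -kermx_eq0; apply/eqP.
set Y := kermx _.
have : Y *m (1%:M + K) = 0 by rewrite mulmx_ker.
rewrite mulmxDr mulmx1 => /eqP; rewrite addr_eq0 => /eqP YE.
have := mx_norm_mul Y K; rewrite -normrN -YE.
have -> : n%:R * `|Y| * `|K| = (n%:R * `|K|) * `|Y| by ring.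
move=> le_Y; apply/eqP; rewrite -normr_eq0 eq_le normr_ge0 andbT.
by rewrite leNgt; apply/negP => Y0; nra.
Qed.

End MatrixNorm.

(** * Banach fixed points in a small ball *)

Lemma small_fixpoint (R : realType) (V : completeNormedModType R) (k : R)
    (F : R -> V -> V) :
  0 < k ->
  (forall r X Y, 0 < r <= 1 -> `|X| <= r -> `|Y| <= r ->
     `|F r X - F r Y| <= k * r * `|X - Y|) ->
  (forall r, 0 < r <= 1 -> `|F r 0| <= k * r ^+ 2) ->
  forall e, 0 < e ->
  exists r X, [/\ 0 < r, r <= 1, r <= e, `|X| <= r & F r X = X].
Proof.
move=> k0 Flip F0 e e0.
(* This choice gives [r <= 1], [r <= e] and [k * r <= 1 / 2] at once. The last bound makes [F r] a
   contraction with ratio [1 / 2] and puts [F r 0] within [r / 2] of the origin, so the ball of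
   radius [r] is mapped to itself. *)
pose r := (1 + e^-1 + 2 * k)^-1.
have D0 : 0 < 1 + e^-1 + 2 * k.
  by rewrite addr_gt0 ?mulr_gt0 // addr_gt0 ?invr_gt0.
have r0 : 0 < r by rewrite invr_gt0.
have r1 : r <= 1.
  rewrite invf_le1 // -addrA lerDl addr_ge0 ?invr_ge0 ?mulr_ge0 ?ltW //.
have re : r <= e.
  rewrite -[e]invrK lef_pV2 ?posrE ?invr_gt0 //.
  have : 0 <= e^-1 by rewrite invr_ge0 ltW.
  lra.
have kr : k * r <= 2^-1.
  rewrite /r ler_pdivrMr //.
  have : 0 < e^-1 by rewrite invr_gt0.
  lra.
have r01 : 0 < r <= 1 by rewrite r0.
pose U := [set X : V | `|X| <= r]%classic.
have FU : set_fun U U (F r).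
  move=> X /= XU.
  have -> : F r X = (F r X - F r 0) + F r 0 by rewrite subrK.
  apply: le_trans (ler_normD _ _) _.
  have U0 : `|0 : V| <= r by rewrite normr0 ltW.
  have h1 := Flip r X 0 r01 XU U0; rewrite subr0 in h1.
  have h2 := F0 r r01.
  have h3 := ler_wpM2r (normr_ge0 X) kr.
  have h4 := ler_wpM2r (ltW r0) kr.
  rewrite /U /= in XU; rewrite expr2 mulrA in h2; lra.
pose HF := isFun.Build V V U U (F r) FU.
pose f : {fun U >-> U} := HB.pack (F r) HF.
have fc : normed_module.is_contraction f.
  have q0 : 0 <= (2^-1 : R) by rewrite invr_ge0.
  exists (NngNum q0); split => /=; first by lra.
  move=> [X Y] /= [XU YU].
  apply: le_trans (Flip r X Y r01 XU YU) _.
  by rewrite ler_wpM2r.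
have Ucl : closed U.
  have -> : U = closed_ball_ (@Num.norm _ V) 0 r.
    by apply/funext => X; rewrite /U /closed_ball_ /= sub0r normrN.
  exact: closed_closed_ball_.
have U0 : (U !=set0)%classic by exists 0; rewrite /U /= normr0 ltW.
have [X XU XE] := banach_fixed_point fc Ucl U0.
by exists r, X; split.
Qed.

HB.instance Definition _ (R : realType) m n := Complete.on 'M[R]_(m, n).

(** * The Frobenius square norm as a trace *)

Section Frobenius.
Variables (R : realType) (m n : nat).
Implicit Types X Y : 'M[R]_(m, n).

Lemma mxtrace_trmul X : \tr (X^T *m X) = \sum_j \sum_i X i j ^+ 2.
Proof.
by apply: eq_bigr => j _; rewrite mxE; apply: eq_bigr => i _; rewrite mxE.
Qed.

Lemma mxtrace_trmul_ge0 X : 0 <= \tr (X^T *m X).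
Proof.
rewrite mxtrace_trmul; apply: sumr_ge0 => j _; apply: sumr_ge0 => i _.
exact: sqr_ge0.
Qed.

Lemma mxtrace_trmul_eq0 X : \tr (X^T *m X) = 0 -> X = 0.
Proof.
rewrite mxtrace_trmul => /eqP; rewrite psumr_eq0; last first.
  by move=> j _; apply: sumr_ge0 => i _; apply: sqr_ge0.
move=> /allP X0; apply/matrixP => i j; rewrite mxE; apply/eqP.
have := X0 j; rewrite mem_index_enum psumr_eq0 => [|k _]; last exact: sqr_ge0.
by move=> /(_ isT)/allP/(_ i); rewrite mem_index_enum sqrf_eq0; apply.
Qed.

End Frobenius.

(** * Injectivity of the linearised operator under the SNIP *)

Section Tangent.
Variables (R : realType) (n : nat) (i : 'I_n) (A S : 'M[R]_n).

(** Replaces the deletion of row [i] by a projection, so that all matrices keep size [n]. *)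
Definition del_proj : 'M[R]_n := diag_mx (\row_a (a != i)%:R).
Local Notation P := del_proj.

Lemma del_projE p (X : 'M[R]_(n, p)) a b :
  (P *m X) a b = if a == i then 0 else X a b.
Proof. by rewrite mul_diag_mx !mxE; case: eqP; rewrite ?mul0r ?mul1r. Qed.

Lemma del_proj_row' p (X : 'M[R]_(n, p)) : P *m X = 0 <-> row' i X = 0.
Proof.
split=> [PX0|rX0].
  apply/matrixP => a b; rewrite !mxE.
  have := congr1 (fun Z : 'M_(_, _) => Z (lift i a) b) PX0.
  by rewrite del_projE mxE eq_sym (negPf (neq_lift _ _)).
apply/matrixP => a b; rewrite del_projE mxE; case: (unliftP i a) => [c ->|->].
  have := congr1 (fun Z : 'M_(_, _) => Z c b) rX0.
  by rewrite !mxE => ->; case: ifP.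
by rewrite eqxx.
Qed.

Lemma del_proj_idem : P *m P = P.
Proof.
apply/matrixP => a b; rewrite del_projE; case: eqP => // ->.
by rewrite !mxE eqxx mul0rn.
Qed.

Lemma del_proj_tr : P^T = P.
Proof. by rewrite tr_diag_mx. Qed.

(* On symmetric [X] the first two terms are [A K + K^T A] with [K = P A X]; the
   last term makes the operator injective on all matrices. *)
Definition snip_op (X : 'M[R]_n) : 'M[R]_n :=
  A *m P *m A *m X + X *m (A *m P *m A) + hadamard S X + (X - X^T).

Lemma snip_op_linear : linear snip_op.
Proof.
move=> c X Y; rewrite /snip_op mulmxDr mulmxDl -scalemxAr -scalemxAl.
have -> : hadamard S (c *: X + Y) = c *: hadamard S X + hadamard S Y.
  by apply/matrixP => a b; rewrite !mxE; ring.
by apply/matrixP => a b; rewrite !mxE; ring.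
Qed.

HB.instance Definition _ :=
  GRing.isLinear.Build R 'M[R]_n 'M[R]_n *:%R snip_op snip_op_linear.

Hypothesis A_sym : A^T = A.
Hypothesis S_ge0 : forall a b, 0 <= S a b.
Hypothesis S_sym : S^T = S.

Lemma snip_op_tr X : (snip_op X)^T = snip_op X^T.
Proof.
rewrite /snip_op !linearD /= !trmx_mul linearN /= trmxK A_sym del_proj_tr.
rewrite !mulmxA; congr (_ + _ + _); first by rewrite addrC.
by apply/matrixP => a b; rewrite !mxE -{1}S_sym mxE.
Qed.

(** Pairing [snip_op X] with [X] under the trace gives four nonnegative terms: the square norms of
    [P A X] and [P A X^T], the [S]-weighted sum of squared entries of [X], and half the square norm
    of [X - X^T]. When all vanish, [X] meets every hypothesis of the SNIP. *)
Lemma snip_op_inj : SNIP i A ->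
  (forall a b, a = b \/ A a b <> 0 -> S a b <> 0) ->
  forall X, snip_op X = 0 -> X = 0.
Proof.
move=> snipA S0 X MX0.
pose Z1 := P *m A *m X; pose Z2 := P *m A *m X^T.
have t1 : \tr (X^T *m (A *m P *m A *m X)) = \tr (Z1^T *m Z1).
  rewrite /Z1 !trmx_mul A_sym del_proj_tr !mulmxA.
  by rewrite -(mulmxA _ P P) del_proj_idem.
have t2 : \tr (X^T *m (X *m (A *m P *m A))) = \tr (Z2^T *m Z2).
  rewrite mxtrace_mulC /Z2 !trmx_mul trmxK A_sym del_proj_tr !mulmxA.
  by rewrite -(mulmxA _ P P) del_proj_idem.
have t3 : \tr (X^T *m hadamard S X) = \sum_j \sum_i S i j * X i j ^+ 2.
  apply: eq_bigr => a _; rewrite mxE; apply: eq_bigr => b _.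
  by rewrite !mxE; ring.
have t3_ge0 : 0 <= \tr (X^T *m hadamard S X).
  rewrite t3; apply: sumr_ge0 => a _; apply: sumr_ge0 => b _.
  by rewrite mulr_ge0 ?sqr_ge0.
have t4 : 2 * \tr (X^T *m (X - X^T)) = \tr ((X - X^T)^T *m (X - X^T)).
  rewrite [(X - _)^T]linearB /= trmxK mulmxBl !mulmxBr !linearB /=.
  rewrite (mxtrace_mulC X X^T) -(mxtrace_tr (X *m X)) trmx_mul; ring.
have := congr1 (fun Z => \tr (X^T *m Z)) MX0.
rewrite /snip_op /=; set D : 'M[R]_n := X - X^T in t4 *.
rewrite !mulmxDr mulmx0 mxtrace0 !mxtraceD t1 t2 => E.
have g1 := mxtrace_trmul_ge0 Z1; have g2 := mxtrace_trmul_ge0 Z2.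
have g4 := mxtrace_trmul_ge0 D.
rewrite {1}/D mulmxDr mxtraceD in t4.
have Z10 : Z1 = 0 by apply: mxtrace_trmul_eq0; lra.
have X_sym : X^T = X.
  by apply/esym/subr0_eq; rewrite -/D; apply: mxtrace_trmul_eq0; lra.
have SX0 a b : S a b * X a b ^+ 2 = 0.
  have : \sum_j \sum_i S i j * X i j ^+ 2 == 0.
    by rewrite -t3; apply/eqP; lra.
  rewrite psumr_eq0 => [/allP/(_ b)|c _]; last first.
    by apply: sumr_ge0 => d _; rewrite mulr_ge0 ?sqr_ge0.
  rewrite mem_index_enum psumr_eq0 => [/(_ isT)/allP/(_ a)|c _]; last first.
    by rewrite mulr_ge0 ?sqr_ge0.
  by rewrite mem_index_enum => /(_ isT)/eqP.
have X0 a b : S a b <> 0 -> X a b = 0.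
  move=> /eqP Sab; apply/eqP; rewrite -sqrf_eq0.
  by have /eqP := SX0 a b; rewrite mulf_eq0 (negPf Sab).
apply: snipA => //.
- apply/matrixP => a b; rewrite !mxE.
  have [->|/eqP Aab] := eqVneq (A a b) 0; first by rewrite mul0r.
  by rewrite (X0 a b) ?mulr0 //; apply: S0; right.
- apply/matrixP => a b; rewrite !mxE; have [->|_] := eqVneq a b.
    by rewrite (X0 b b) ?mulr0 //; apply: S0; left.
  by rewrite mul0r.
- by apply/del_proj_row'; rewrite mulmxA.
Qed.

End Tangent.

(** * Perturbing [A] inside its congruence orbit *)

Definition restr_row (R : realType) n (nu : pred 'I_n) (w : 'I_n)
    (C : 'M[R]_n) : 'rV[R]_n := \row_a (if nu a then C w a else 0).

Definition closed_adj (R : realType) n (G : sgraph n) : 'M[R]_n :=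
  \matrix_(a, b) ((a == b) || edge G a b)%:R.

Section Perturbation.
Variables (R : realType) (n : nat).
Implicit Types (G : sgraph n) (nu : pred 'I_n) (w i : 'I_n) (A C X Y : 'M[R]_n).

Lemma norm_restr_row nu w C : `|restr_row nu w C| <= `|C|.
Proof.
apply: mx_norm_le => // a b; rewrite mxE; case: ifP => _.
  exact: mx_norm_entry.
by rewrite normr0.
Qed.

Lemma restr_rowB nu w C D :
  restr_row nu w C - restr_row nu w D = restr_row nu w (C - D).
Proof. by apply/rowP => a; rewrite !mxE; case: ifP; rewrite ?subrr. Qed.

Lemma norm_hadamard_closed_adj G X : `|hadamard (closed_adj R G) X| <= `|X|.
Proof.
apply: mx_norm_le => // a b; rewrite !mxE; case: (_ || _).
  by rewrite mul1r mx_norm_entry.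
by rewrite mul0r normr0.
Qed.

Lemma closed_adj_sym G : (closed_adj R G)^T = closed_adj R G.
Proof. by apply/matrixP => a b; rewrite !mxE eq_sym edge_sym. Qed.

Lemma norm_scalar_mx1 (c : R) : `|c%:M : 'M[R]_1| <= `|c|.
Proof. by apply: mx_norm_le => // a b; rewrite mxE !ord1 eqxx. Qed.

Lemma SNIP_op_inverse G i A : in_S G A -> SNIP i A ->
  let M := snip_op i A (closed_adj R G) in
  exists g : {linear 'M[R]_n -> 'M[R]_n}, exists2 k : R, 0 < k &
  [/\ cancel g M, cancel M g & forall X, `|g X| <= k * `|X|].
Proof.
move=> [A_sym A_edge] snipA.
have Minj : forall X, snip_op i A (closed_adj R G) X = 0 -> X = 0.
  apply: snip_op_inj => // [a b|a b ab]; rewrite mxE ?ler0n //.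
  apply/eqP; rewrite pnatr_eq0 eqb0 negbK.
  have [//|/eqP neq_ab] := eqVneq a b.
  by case: ab => // Aab; apply/(A_edge a b neq_ab).
have [g [gM Mg]] := linear_mx_inj_inverse Minj.
by have [k k0 gk] := linear_mx_bounded g; exists g, k.
Qed.

(** The last clause is a SNIP for [B] in which entries of [Y] on edges need only be small. This
    slack is required because the SNIP hypotheses for the split matrix do not force zeros at all
    edges of [w]. *)
Lemma SNIP_perturbation G i A w nu : in_S G A -> SNIP i A ->
  exists (s : R) C (K : 'M[R]_n),
    let c := restr_row nu w C in let B := C - s *: (c^T *m c) in
    [/\ 0 < s, in_S G C, row i K = 0,
        1%:M + K \in unitmx /\ (1%:M + K)^T *m A *m (1%:M + K) = B
      & forall Y, Y^T = Y -> (forall a, Y a a = 0) ->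
          (forall a b, edge G a b -> `|Y a b| <= s * `|c *m Y|) ->
          row' i (B *m Y) = 0 -> Y = 0].
Proof.
move=> hA snipA; have [A_sym A_edge] := hA.
have [g [k k0 [gM Mg gk]]] := SNIP_op_inverse hA snipA.
set S := closed_adj R G in gM Mg *; set M := snip_op i A S in gM Mg *.
have Mk Y : `|Y| <= k * `|M Y| by rewrite -{1}(Mg Y).
pose P := del_proj R i; pose J := P *m A.
pose cr X := restr_row nu w (A - hadamard S X).
(* With [K = J X] and [c = cr X], a fixed point satisfies [M X = - (K^T A K + r^2 c^T c)], which is
   the equation [(1 + K)^T A (1 + K) = C - r^2 c^T c] once [X] is symmetric. Writing [r^2] as a 1 by
   1 matrix lets [mx_norm_quadB] treat both summands. *)
pose F r X : 'M[R]_n := - g ((J *m X)^T *m A *m (J *m X)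
                  + (cr X)^T *m (r ^+ 2)%:M *m cr X).
pose al := `|A|; pose kap := n%:R * `|J|; pose N : R := n%:R.
have al0 : 0 <= al := normr_ge0 A.
have k_ge0 := ltW k0.
have N0 : 0 <= N := ler0n _ _.
have kap0 : 0 <= kap by rewrite mulr_ge0.
have hJ X : `|J *m X| <= kap * `|X| := mx_norm_mul J X.
have hSX X : `|A - hadamard S X| <= al + `|X|.
  by apply: le_trans (ler_normB _ _) _; rewrite lerD2l norm_hadamard_closed_adj.
have hcr X : `|cr X| <= al + `|X|.
  exact: le_trans (norm_restr_row _ _ _) (hSX X).
have hcrB X Y : `|cr X - cr Y| <= `|X - Y|.
  rewrite restr_rowB; apply: le_trans (norm_restr_row _ _ _) _.
  have -> : A - hadamard S X - (A - hadamard S Y) = - hadamard S (X - Y).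
    by apply/matrixP => a b; rewrite !mxE; ring.
  by rewrite normrN norm_hadamard_closed_adj.
(* The first two summands bound the Lipschitz constants of the two quadratic terms, [al ^+ 2] bounds
   the value at 0, and the final 1 gives positivity. *)
pose k' := k * (2 * N ^+ 2 * al * kap ^+ 2 + 2 * (al + 1) + al ^+ 2) + 1.
have k'0 : 0 < k'.
  rewrite /k' ltr_wpDl // mulr_ge0 ?(ltW k0) //.
  by rewrite !(sqr_ge0, addr_ge0, mulr_ge0).
have Flip r X Y : 0 < r <= 1 -> `|X| <= r -> `|Y| <= r ->
    `|F r X - F r Y| <= k' * r * `|X - Y|.
  case/andP=> r0 r1 Xr Yr; have r_ge0 := ltW r0.
  rewrite /F opprK addrC -linearB /=; apply: le_trans (gk _) _.
  rewrite opprD addrACA.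
  set q1 := (X in `|X + _|); set q2 := (X in `|_ + X|).
  have h1 : `|q1| <= N ^+ 2 * al * (kap * r + kap * r) * (kap * `|X - Y|).
    rewrite /q1 -normrN opprB; apply: le_trans (mx_norm_quadB _ _ _) _.
    rewrite -mulmxBr; apply: ler_pM; rewrite ?mulr_ge0 ?addr_ge0 ?sqr_ge0 //.
    rewrite ler_wpM2l ?mulr_ge0 ?sqr_ge0 // lerD //.
      by apply: le_trans (hJ X) _; rewrite ler_wpM2l.
    by apply: le_trans (hJ Y) _; rewrite ler_wpM2l.
  have h2 : `|q2| <= r * (2 * (al + 1)) * `|X - Y|.
    rewrite /q2 -normrN opprB; apply: le_trans (mx_norm_quadB _ _ _) _.
    rewrite expr1n mul1r; apply: ler_pM; rewrite ?mulr_ge0 ?addr_ge0 //.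
    apply: ler_pM; rewrite ?addr_ge0 //.
      apply: le_trans (norm_scalar_mx1 _) _.
      by rewrite ger0_norm ?sqr_ge0 // expr2 ler_piMr // ltW.
    have := hcr X; have := hcr Y; lra.
  have h3 := ler_normD q1 q2.
  apply: (@le_trans _ _ (k * (N ^+ 2 * al * (kap * r + kap * r)
      * (kap * `|X - Y|) + r * (2 * (al + 1)) * `|X - Y|))).
    by rewrite ler_wpM2l ?(ltW k0) //; apply: le_trans h3 _; rewrite lerD.
  rewrite -subr_ge0.
  have -> : k' * r * `|X - Y| - k * (N ^+ 2 * al * (kap * r + kap * r)
      * (kap * `|X - Y|) + r * (2 * (al + 1)) * `|X - Y|)
      = (k * al ^+ 2 + 1) * (r * `|X - Y|) by rewrite /k'; ring.
  by rewrite !(sqr_ge0, addr_ge0, mulr_ge0).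
have F0 r : 0 < r <= 1 -> `|F r 0| <= k' * r ^+ 2.
  move=> _; rewrite /F normrN; apply: le_trans (gk _) _.
  rewrite !mulmx0 add0r.
  have := mx_norm_quadB (r ^+ 2)%:M (cr 0) 0.
  rewrite trmx0 !mul0mx !subr0 normr0 addr0 expr1n mul1r => hq.
  have h1 : `|(cr 0)^T *m (r ^+ 2)%:M *m cr 0| <= r ^+ 2 * al * al.
    apply: le_trans hq _; have := hcr 0; rewrite normr0 addr0 => h0.
    apply: ler_pM; rewrite ?mulr_ge0 //; apply: ler_pM => //.
    by apply: le_trans (norm_scalar_mx1 _) _; rewrite ger0_norm ?sqr_ge0.
  apply: (@le_trans _ _ (k * (r ^+ 2 * al * al))).
    by rewrite ler_wpM2l // ltW.
  rewrite -subr_ge0.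
  have -> : k' * r ^+ 2 - k * (r ^+ 2 * al * al) =
    (k * (2 * N ^+ 2 * al * kap ^+ 2 + 2 * (al + 1)) + 1) * r ^+ 2.
    by rewrite /k'; ring.
  by rewrite !(sqr_ge0, addr_ge0, mulr_ge0).
(* [r * Om <= 1] makes [C] keep the zero pattern of [A] (inv_sum), makes
   [1 + K] invertible (N * kap) and keeps the SNIP (tau). *)
pose inv_sum := \sum_a \sum_b `|A a b|^-1.
pose tau := k * (2 * N ^+ 2 * `|A *m P| * (1 + (al + 1) ^+ 2) + N * (al + 1)).
have inv0 : 0 <= inv_sum.
  by apply: sumr_ge0 => a _; apply: sumr_ge0 => b _; rewrite invr_ge0.
have Nkap0 : 0 <= N * kap by rewrite mulr_ge0.
have tau0 : 0 <= tau.
  by rewrite !(sqr_ge0, addr_ge0, mulr_ge0).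
pose Om := 1 + inv_sum + N * kap + tau.
have Om0 : 0 < Om by rewrite /Om; lra.
have eps0 : 0 < Om^-1 by rewrite invr_gt0.
have [r [X [r0 r1 rOm Xr FX]]] := small_fixpoint k'0 Flip F0 eps0.
have r_ge0 := ltW r0.
have rOm1 : r * Om <= 1 by rewrite -(mulVf (lt0r_neq0 Om0)) ler_wpM2r // ltW.
have r_lt z : 0 <= z -> z <= inv_sum + N * kap + tau -> r * z < 1.
  move=> z0 zle; apply: lt_le_trans rOm1.
  by rewrite ltr_pM2l // /Om; lra.
pose C := A - hadamard S X; pose K := J *m X.
have MX : M X = - (K^T *m A *m K + (cr X)^T *m (r ^+ 2)%:M *m cr X).
  by rewrite -[in LHS]FX /F /M linearN /= -/M gM.
(* [M] commutes with transposition and the right-hand side of [MX] is symmetric, so injectivity of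
   [M] applies. *)
have X_sym : X^T = X.
  apply: (can_inj Mg); rewrite {1}/M -snip_op_tr ?closed_adj_sym // -/M MX.
  by rewrite linearN linearD /= !trmx_mul !trmxK A_sym tr_scalar_mx !mulmxA.
exists (r ^+ 2), C, K => c B.
have BE : (1%:M + K)^T *m A *m (1%:M + K) = B.
  have K_A : K^T *m A = X *m (A *m P *m A).
    by rewrite /K /J !trmx_mul X_sym A_sym del_proj_tr !mulmxA.
  have A_K : A *m K = A *m P *m A *m X by rewrite /K /J !mulmxA.
  have MXE : A *m P *m A *m X + X *m (A *m P *m A) = M X - hadamard S X.
    by rewrite /M /snip_op -/P X_sym subrr addr0 addrK.
  rewrite [(_ + K)^T]linearD /= trmx1 mulmxDl mul1mx mulmxDr mulmx1 mulmxDl.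
  rewrite K_A A_K -K_A.
  have -> : A + K^T *m A + (A *m P *m A *m X + K^T *m A *m K) =
     A + (A *m P *m A *m X + K^T *m A) + K^T *m A *m K.
    by apply/matrixP => a b; rewrite !mxE; ring.
  rewrite {1}K_A MXE MX -[cr X]/c mul_mx_scalar -scalemxAl /B /C.
  by apply/matrixP => a b; rewrite !mxE; ring.
have C_in : in_S G C.
  split; first by rewrite /symmetric_mx linearB /= A_sym; congr (_ - _);
    apply/matrixP => a b; rewrite !mxE -{1}X_sym mxE eq_sym edge_sym.
  move=> a b neq_ab; have Aab := A_edge a b neq_ab.
  rewrite !mxE; case: eqP => //= _.
  case: (boolP (edge G a b)) => Gab; last first.
    rewrite mul0r subr0; split=> [/Aab|//]; by rewrite (negPf Gab).
  split=> // _; rewrite mul1r => /eqP; rewrite subr_eq0 => /eqP AX.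
  have /eqP A0 : A a b <> 0 by apply/Aab.
  have A0' : 0 < `|A a b| by rewrite normr_gt0.
  have : r * `|A a b|^-1 < 1.
    apply: r_lt; first by rewrite invr_ge0.
    have : `|A a b|^-1 <= inv_sum; last lra.
    rewrite /inv_sum (bigD1 a) //= (bigD1 b) //= -addrA lerDl addr_ge0 //.
      by apply: sumr_ge0 => d _; rewrite invr_ge0.
    by apply: sumr_ge0 => d _; apply: sumr_ge0 => e _; rewrite invr_ge0.
  rewrite ltr_pdivrMr // mul1r ltNge.
  by rewrite AX (le_trans (mx_norm_entry _ _ _)).
split=> //.
- by rewrite exprn_gt0.
- apply/rowP => a; rewrite /K /J -mulmxA mxE del_projE eqxx.
  by rewrite mxE.
- split=> //; apply: unitmx_perturb1.
  apply: (@le_lt_trans _ _ (r * (N * kap))); last by apply: r_lt => //; lra.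
  have -> : r * (N * kap) = N * (kap * r) by ring.
  rewrite ler_wpM2l //; apply: le_trans (hJ X) _.
  by rewrite ler_wpM2l.
move=> Y Y_sym Y_diag Y_edge BY0.
have c_le : `|c| <= al + 1 by have := hcr X; rewrite -[cr X]/c; lra.
have r2 : r ^+ 2 <= r by rewrite expr2 ler_piMr // ltW.
have d_le : `|B - A| <= r * (1 + (al + 1) ^+ 2).
  have -> : B - A = - (hadamard S X + r ^+ 2 *: (c^T *m c)).
    by rewrite /B /C; apply/matrixP => a b; rewrite !mxE; ring.
  rewrite normrN; apply: le_trans (ler_normD _ _) _.
  rewrite mulrDr mulr1 lerD //.
    exact: le_trans (norm_hadamard_closed_adj _ _) Xr.
  rewrite normrZ ger0_norm ?sqr_ge0 //; apply: ler_pM => //.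
    exact: sqr_ge0.
  apply: le_trans (mx_norm_mul _ _) _; rewrite mul1r mx_norm_tr expr2.
  by apply: ler_pM.
(* Since [P B Y = 0], only the difference [B - A], of order [r], contributes. *)
have APAY : A *m P *m A *m Y = - (A *m P *m (B - A) *m Y).
  have PBY : P *m (B *m Y) = 0 by apply/del_proj_row'.
  rewrite mulmxBr mulmxBl opprB -[A *m P *m B *m Y]mulmxA.
  rewrite -[A *m P *m (B *m Y)]mulmxA.
  by rewrite PBY mulmx0 subr0.
have APAY_le : `|A *m P *m A *m Y|
    <= N ^+ 2 * `|A *m P| * (r * (1 + (al + 1) ^+ 2)) * `|Y|.
  rewrite APAY normrN; apply: le_trans (mx_norm_mul _ _) _.
  rewrite ler_wpM2r // expr2 -!(mulrA N) ler_wpM2l //.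
  apply: le_trans (mx_norm_mul _ _) _.
  by rewrite -!mulrA ler_wpM2l // ler_wpM2l.
have SY_le : `|hadamard S Y| <= r * (N * (al + 1)) * `|Y|.
  have cY : `|c *m Y| <= N * (al + 1) * `|Y|.
    apply: le_trans (mx_norm_mul _ _) _.
    by rewrite ler_wpM2r // ler_wpM2l.
  apply: mx_norm_le => [|a b].
    by rewrite !(addr_ge0, mulr_ge0).
  rewrite !mxE; have [->|neq_ab] /= := eqVneq a b.
    by rewrite Y_diag mulr0 normr0 !(addr_ge0, mulr_ge0).
  case: (boolP (edge G a b)) => Gab; last first.
    by rewrite mul0r normr0 !(addr_ge0, mulr_ge0).
  rewrite mul1r; apply: le_trans (Y_edge a b Gab) _.
  by rewrite -mulrA; apply: ler_pM => //; rewrite sqr_ge0.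
have YAPA : Y *m (A *m P *m A) = (A *m P *m A *m Y)^T.
  by rewrite !trmx_mul Y_sym A_sym del_proj_tr !mulmxA.
have MY : `|M Y| <= `|A *m P *m A *m Y| + `|A *m P *m A *m Y| + `|hadamard S Y|.
  rewrite /M /snip_op -/P Y_sym subrr addr0 YAPA.
  apply: le_trans (ler_normD _ _) _; rewrite lerD2r.
  by apply: le_trans (ler_normD _ _) _; rewrite mx_norm_tr.
(* For symmetric [Y] every part of [M Y] is of order [r |Y|], while [|Y|] is at most [k |M Y|];
   [tau] collects the constants, and [r * tau < 1] leaves only [Y = 0]. *)
have Y_le : `|Y| <= r * tau * `|Y|.
  apply: le_trans (Mk Y) _.
  have -> : r * tau * `|Y| = k * (N ^+ 2 * `|A *m P| * (r * (1 + (al + 1) ^+ 2))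
     * `|Y| + N ^+ 2 * `|A *m P| * (r * (1 + (al + 1) ^+ 2)) * `|Y|
     + r * (N * (al + 1)) * `|Y|) by rewrite /tau; ring.
  rewrite ler_wpM2l ?(ltW k0) //; apply: le_trans MY _.
  by rewrite !lerD.
have rtau : r * tau < 1 by apply: r_lt => //; lra.
apply/eqP; rewrite -normr_eq0 eq_le normr_ge0 andbT leNgt; apply/negP => Y0.
by move: Y_le; rewrite leNgt gtr_pMl // rtau.
Qed.

End Perturbation.

(** * Nullities of matrices with pinned coordinates, and congruence *)

Section Nullity.
Variable R : realType.

(** [Q] carries the kernel of [M] injectively into that of [N]; the columns of a square [X] are
    enough to hold a spanning set of the kernel. *)
Lemma nullity_le m n (M : 'M[R]_m) (N : 'M[R]_n) (Q : 'M[R]_(n, m)) :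
  (forall X : 'M[R]_m, M *m X = 0 -> N *m (Q *m X) = 0) ->
  (forall X : 'M[R]_m, M *m X = 0 -> Q *m X = 0 -> X = 0) ->
  (nullity M <= nullity N)%N.
Proof.
move=> MN Qinj; rewrite /nullity; set Z := cokermx M.
have MZ : M *m Z = 0 by apply: mulmx_coker.
apply: (@leq_trans (\rank (Q *m Z))).
  (* [Z *m cokermx (Q *m Z)] is killed by both [M] and [Q], hence is zero; so the row space of [Z]
     lies in that of [Q *m Z]. *)
  apply: mxrankS; rewrite submxE; apply/eqP/Qinj; rewrite mulmxA.
    by rewrite MZ mul0mx.
  by rewrite mulmx_coker.
have := mulmx0_rank_max (MN Z MZ); rewrite mxrank_coker => rk.
by rewrite leq_subRL ?rank_leq_row.
Qed.

(* Its kernel is that of [A] with the rows and columns in [b] deleted, extended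
   by zero: this keeps the size of [A] when comparing nullities. *)
Definition pinned n (b : pred 'I_n) (A : 'M[R]_n) : 'M[R]_n :=
  \matrix_(k, l) (if b k || b l then (k == l)%:R else A k l).

Lemma pinned_kerP n p (b : pred 'I_n) (A : 'M[R]_n) (X : 'M[R]_(n, p)) :
  pinned b A *m X = 0 <->
  (forall k l, b k -> X k l = 0) /\ (forall k l, ~~ b k -> (A *m X) k l = 0).
Proof.
have pinnedE k l : b k -> (pinned b A *m X) k l = X k l.
  move=> bk; rewrite mxE (bigD1 k) //= mxE bk eqxx mul1r big1 ?addr0 // => a.
  by rewrite mxE bk eq_sym /= => /negPf->; rewrite mul0r.
have pinnedNE k l : (forall k l, b k -> X k l = 0) -> ~~ b k ->
    (pinned b A *m X) k l = (A *m X) k l.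
  move=> X0 nbk; rewrite !mxE; apply: eq_bigr => a _.
  rewrite mxE (negPf nbk) /=.
  by case: ifP => // ba; rewrite X0 ?mulr0.
split=> [bX0|[X0 AX0]].
  have X0 k l : b k -> X k l = 0 by move=> bk; rewrite -pinnedE // bX0 mxE.
  by split=> // k l nbk; rewrite -pinnedNE // bX0 mxE.
apply/matrixP => k l; rewrite [RHS]mxE; case: (boolP (b k)) => bk.
  by rewrite pinnedE // X0.
by rewrite pinnedNE // AX0.
Qed.

Lemma pinned_pred0 n (A : 'M[R]_n) : pinned pred0 A = A.
Proof. by apply/matrixP => k l; rewrite mxE. Qed.

Lemma row'_mul n p q (i : 'I_n) (A : 'M[R]_(n, p)) (X : 'M[R]_(p, q)) :
  row' i (A *m X) = row' i A *m X.
Proof. by rewrite !row'Esub mul_rowsub_mx. Qed.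

(** Extension by zero at [i], given by [E], and [row' i] are inverse maps between the two
    kernels. *)
Lemma nullity_pinned1 n (i : 'I_n) (A : 'M[R]_n) :
  nullity (pinned (pred1 i) A) = nullity (principal_del i A).
Proof.
pose E : 'M[R]_(n, n.-1) := col' i 1%:M.
have rE p (Y : 'M[R]_(n.-1, p)) : row' i (E *m Y) = Y.
  rewrite row'_mul -[RHS]mul1mx; congr (_ *m _); apply/matrixP => a b.
  by rewrite !mxE (inj_eq lift_inj).
have E0 p (Y : 'M[R]_(n.-1, p)) l : (E *m Y) i l = 0.
  rewrite mxE big1 // => a _.
  by rewrite !mxE (negPf (neq_lift _ _)) mul0r.
have Er p (X : 'M[R]_(n, p)) : (forall l, X i l = 0) -> E *m row' i X = X.
  move=> X0; apply/matrixP => k l; case: (unliftP i k) => [a ->|->].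
    by have /matrixP/(_ a l) := rE _ (row' i X); rewrite !mxE.
  by rewrite E0 X0.
have dE p (Y : 'M[R]_(n.-1, p)) :
    principal_del i A *m Y = row' i (A *m (E *m Y)).
  have -> : principal_del i A = row' i (A *m E).
    by rewrite /principal_del /E col'Esub mulmx_colsub mulmx1 -col'Esub.
  by rewrite -row'_mul mulmxA.
apply/eqP; rewrite eqn_leq; apply/andP; split.
  apply: (@nullity_le _ _ _ _ (row' i 1%:M)) => X /pinned_kerP [X0 AX0].
    rewrite -[row' i 1%:M *m X]row'_mul mul1mx dE Er => [|l]; last first.
      by apply: X0 => /=.
    apply/matrixP => a l; rewrite !mxE.
    by have := AX0 (lift i a) l; rewrite mxE /= eq_sym neq_lift => ->.
  rewrite -row'_mul mul1mx => rX; rewrite -[X]Er ?rX ?mulmx0 // => l.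
  by apply: X0 => /=.
apply: (@nullity_le _ _ _ _ E) => Y dY0; last first.
  by move=> EY; rewrite -(rE _ Y) EY; apply/matrixP => a b; rewrite !mxE.
apply/pinned_kerP; split=> [k l /eqP->|k l /= ki]; first exact: E0.
case: (unliftP i k) ki => [a -> _|->]; last by rewrite eqxx.
have := dY0; rewrite dE => /matrixP/(_ a l).
by rewrite [LHS]mxE [RHS]mxE.
Qed.

Lemma invmx_id_row n (b : pred 'I_n) (L : 'M[R]_n) : L \in unitmx ->
  (forall k, b k -> row k L = row k 1%:M) ->
  forall k, b k -> row k (invmx L) = row k 1%:M.
Proof.
move=> Lu Lb k bk; rewrite -(mulmxV Lu) row_mul Lb // -row_mul.
by rewrite mul1mx.
Qed.

(** The kernel is transported by [L]. Identity rows of [L] at pinned indices keep the pinned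
    coordinates zero. The same rows of [invmx L] are identity rows too, so the unpinned rows of
    [A L X] combine only unpinned rows of [L^T A L X]. *)
Lemma nullity_pinned_congr_le n (b : pred 'I_n) (A L : 'M[R]_n) :
  L \in unitmx -> (forall k, b k -> row k L = row k 1%:M) ->
  (nullity (pinned b (L^T *m A *m L)) <= nullity (pinned b A))%N.
Proof.
move=> Lu Lb; apply: (@nullity_le _ _ _ _ L) => X; last first.
  by move=> _ LX; rewrite -(mulKmx Lu X) LX mulmx0.
move=> /pinned_kerP [X0 BX0]; apply/pinned_kerP; split=> [k l bk|k l nbk].
  have := congr1 (fun Z : 'M_(1, n) => (Z *m X) 0 l) (Lb k bk).
  by rewrite -!row_mul mul1mx !mxE => ->; apply: X0.
have -> : A *m (L *m X) = (invmx L)^T *m (L^T *m A *m L *m X).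
  by rewrite -!mulmxA [RHS]mulmxA -trmx_mul mulmxV // trmx1 mul1mx.
rewrite mxE big1 // => a _; case: (boolP (b a)) => ba.
  have := congr1 (fun Z : 'M_(1, n) => Z 0 k) (invmx_id_row Lu Lb ba).
  rewrite !mxE => ->; case: eqP => [ak|_]; last by rewrite mul0r.
  by rewrite -ak ba in nbk.
by rewrite (BX0 a) ?mulr0.
Qed.

Lemma nullity_pinned_congr n (b : pred 'I_n) (A L : 'M[R]_n) :
  L \in unitmx -> (forall k, b k -> row k L = row k 1%:M) ->
  nullity (pinned b (L^T *m A *m L)) = nullity (pinned b A).
Proof.
move=> Lu Lb; apply/eqP; rewrite eqn_leq nullity_pinned_congr_le //=.
have {1}-> : A = (invmx L)^T *m (L^T *m A *m L) *m invmx L.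
  by rewrite -!mulmxA mulmxV // mulmx1 mulmxA -trmx_mul mulmxV // trmx1 mul1mx.
apply: nullity_pinned_congr_le; first by rewrite unitmx_inv.
exact: invmx_id_row.
Qed.

End Nullity.

(** * The split matrix: [psi] lets [v] stand for [w], and [u] is the extra coordinate *)

Section VertexSplit.
Variables (R : realType) (m n : nat) (u v : 'I_m) (w : 'I_n).
Variables (phi : 'I_m -> 'I_n) (psi : 'I_n -> 'I_m).
Hypothesis psiK : cancel psi phi.
Hypothesis psi_neq : forall a, psi a != u.
Hypothesis phiK : forall x, x != u -> psi (phi x) = x.
Hypothesis psi_w : psi w = v.
Variables (s : R) (c : 'rV[R]_n) (B : 'M[R]_n).
Hypothesis s_gt0 : 0 < s.

Let v_neq_u : v != u. Proof. by rewrite -psi_w psi_neq. Qed.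

Definition restr_mx : 'M[R]_(n, m) := rowsub psi 1%:M.
Definition split_row : 'rV[R]_m :=
  delta_mx 0 u - delta_mx 0 v + s *: (c *m restr_mx).
(** As a quadratic form this is [B] plus [(1 / s) (x_u - x_v + s c x)^2]. For [B = C - s c^T c] the
    square of [c x] cancels, leaving [C + 2 (x_u - x_v) c x + (1 / s) (x_u - x_v)^2]: the weights
    [c] move from [v] to [u]. *)
Definition split_mx : 'M[R]_m :=
  restr_mx^T *m B *m restr_mx + s^-1 *: (split_row^T *m split_row).

Local Notation Q := restr_mx.
Local Notation h := split_row.

Lemma restr_mulE p (X : 'M[R]_(m, p)) a l : (Q *m X) a l = X (psi a) l.
Proof. by rewrite mul_rowsub_mx mul1mx mxE. Qed.

Lemma restr_tr_mulE p (X : 'M[R]_(n, p)) x l :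
  (Q^T *m X) x l = if x == u then 0 else X (phi x) l.
Proof.
rewrite mxE; case: eqP => [->|/eqP xu].
  by rewrite big1 // => a _; rewrite !mxE (negPf (psi_neq a)) mul0r.
rewrite (bigD1 (phi x)) //= !mxE phiK // eqxx mul1r big1 ?addr0 // => a ax.
rewrite !mxE; case: eqP => [E|_]; last by rewrite mul0r.
by rewrite -E psiK eqxx in ax.
Qed.

Lemma mul_restrE p (X : 'M[R]_(p, n)) l x :
  (X *m Q) l x = if x == u then 0 else X l (phi x).
Proof.
by have := restr_tr_mulE X^T x l; rewrite -trmx_mul !mxE => ->.
Qed.

Lemma mul_restr_trE p (X : 'M[R]_(p, m)) l a : (X *m Q^T) l a = X l (psi a).
Proof.
by have := restr_mulE X^T a l; rewrite -[X in X *m _]trmxK -trmx_mul !mxE.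
Qed.

Lemma restr_mul_tr : Q *m Q^T = 1%:M.
Proof.
apply/matrixP => a b; rewrite restr_mulE !mxE.
by rewrite (inj_eq (can_inj psiK)) eq_sym.
Qed.

Lemma restr_mul_u : Q *m delta_mx u 0 = 0 :> 'cV_n.
Proof.
by apply/matrixP => a b; rewrite restr_mulE !mxE (negPf (psi_neq a)).
Qed.

Lemma split_row_u : h *m delta_mx u 0 = 1%:M.
Proof.
rewrite /split_row mulmxDl mulmxBl -scalemxAl -mulmxA restr_mul_u mulmx0.
rewrite scaler0 addr0 mul_delta_mx (mul_delta_mx_0 _ _ _ v_neq_u) subr0.
by apply/matrixP => a b; rewrite !ord1 !mxE.
Qed.

Lemma restr_decomp p (X : 'M[R]_(m, p)) :
  X = Q^T *m (Q *m X) + delta_mx u 0 *m row u X.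
Proof.
apply/matrixP => x l; rewrite mxE restr_tr_mulE.
rewrite [(delta_mx _ _ *m _) _ _]mxE big_ord1 [delta_mx _ _ _ _]mxE.
rewrite [row _ _ _ _]mxE eqxx andbT.
case: eqP => [->|/eqP xu]; first by rewrite mul1r add0r.
by rewrite restr_mulE phiK // mul0r addr0.
Qed.

Lemma split_mx_mul p (X : 'M[R]_(m, p)) :
  split_mx *m X = Q^T *m (B *m (Q *m X)) + s^-1 *: (h^T *m (h *m X)).
Proof. by rewrite mulmxDl -scalemxAl !mulmxA. Qed.

Lemma split_mx_mul_u p (X : 'M[R]_(m, p)) l :
  (split_mx *m X) u l = s^-1 * (h *m X) 0 l.
Proof.
rewrite split_mx_mul mxE restr_tr_mulE eqxx add0r mxE; congr (_ * _).
rewrite mxE big_ord1 mxE.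
have := congr1 (fun Z : 'M_1 => Z 0 0) split_row_u.
by rewrite -colE !mxE => ->; rewrite mul1r.
Qed.

(** Row [u] of [split_mx] is [h / s], because row [u] of [Q^T] is zero and [h] has entry 1 at
    [u]. *)
Lemma split_mx_row_u_eq0 p (X : 'M[R]_(m, p)) :
  (forall l, (split_mx *m X) u l = 0) -> h *m X = 0.
Proof.
move=> X0; apply/matrixP => a l; rewrite ord1 [RHS]mxE.
have /eqP := X0 l; rewrite split_mx_mul_u mulf_eq0 invr_eq0.
by rewrite (gt_eqF s_gt0) /= => /eqP.
Qed.

Lemma split_mx_mul_ker p (X : 'M[R]_(m, p)) a l : h *m X = 0 ->
  (split_mx *m X) (psi a) l = (B *m (Q *m X)) a l.
Proof.
move=> hX; rewrite split_mx_mul hX mulmx0 scaler0 addr0 restr_tr_mulE.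
by rewrite (negPf (psi_neq a)) psiK.
Qed.

Lemma restr_split_inj p (X : 'M[R]_(m, p)) : Q *m X = 0 -> h *m X = 0 -> X = 0.
Proof.
move=> QX; rewrite (restr_decomp X) QX mulmx0 add0r mulmxA split_row_u.
by rewrite mul1mx => ->; rewrite mulmx0.
Qed.

(** As [u] is not pinned, its equation forces [h X = 0], and the remaining equations then become
    those of [B] for [Q X]. *)
Lemma nullity_pinned_split (b : pred 'I_n) (b' : pred 'I_m) :
  ~~ b' u -> (forall a, b' (psi a) = b a) ->
  nullity (pinned b' split_mx) = nullity (pinned b B).
Proof.
move=> b'u b'psi; apply/eqP; rewrite eqn_leq; apply/andP; split.
  apply: (@nullity_le _ _ _ _ _ Q) => X /pinned_kerP [X0 AX0];
    have hX : h *m X = 0 by [apply: split_mx_row_u_eq0 => l; apply: AX0].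
    apply/pinned_kerP; split=> [k l bk|k l bk].
      by rewrite restr_mulE X0 ?b'psi.
    by rewrite -split_mx_mul_ker // AX0 ?b'psi.
  by move=> QX; apply: restr_split_inj.
(* The inverse of [Q] on the kernel of [h]: coordinate [u] is chosen to make [h] vanish. *)
pose W : 'M[R]_(m, n) := Q^T - delta_mx u 0 *m (h *m Q^T).
have QW : Q *m W = 1%:M.
  rewrite /W mulmxBr [Q *m (delta_mx _ _ *m _)]mulmxA restr_mul_u mul0mx.
  by rewrite subr0 restr_mul_tr.
have hW : h *m W = 0.
  rewrite /W mulmxBr [h *m (delta_mx _ _ *m _)]mulmxA split_row_u mul1mx.
  by rewrite subrr.
apply: (@nullity_le _ _ _ _ _ W) => Y /pinned_kerP [Y0 BY0]; last first.
  by move=> WY; rewrite -[Y]mul1mx -QW -mulmxA WY mulmx0.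
have QWY : Q *m (W *m Y) = Y by rewrite mulmxA QW mul1mx.
apply/pinned_kerP; split=> k l bk.
  have ku : k != u by apply: contraNneq b'u => <-.
  rewrite -(phiK ku) -restr_mulE QWY Y0 // -b'psi phiK //.
rewrite split_mx_mul [h *m (W *m Y)]mulmxA hW mul0mx mulmx0 scaler0 addr0 QWY.
rewrite restr_tr_mulE; case: eqP => // /eqP ku.
by rewrite BY0 // -b'psi phiK.
Qed.

Lemma split_rowE x :
  h 0 x = if x == u then 1 else s * c 0 (phi x) - (x == v)%:R.
Proof.
have := mul_restrE c 0 x; rewrite /split_row; move: (c *m Q) => z zE.
rewrite !mxE zE !eqxx /=.
case: eqP => [->|_]; first by rewrite eq_sym (negPf v_neq_u) subr0 mulr0 addr0.
by rewrite sub0r addrC.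
Qed.

Lemma split_mxE x y :
  split_mx x y = (if (x == u) || (y == u) then 0 else B (phi x) (phi y))
                 + s^-1 * (h 0 x * h 0 y).
Proof.
rewrite /split_mx; set Z := _ *m B *m Q; set H := _^T *m _.
have -> : (Z + s^-1 *: H) x y = Z x y + s^-1 * H x y by rewrite !mxE.
congr (_ + _ * _); last by rewrite /H mxE big_ord1 mxE.
by rewrite /Z mul_restrE; case: (y == u); rewrite ?orbT // orbF restr_tr_mulE.
Qed.

End VertexSplit.

(** * From the contraction back to [H] *)

Section Decontraction.
Variables (m n : nat) (H : sgraph m) (u v : 'I_m).
Variables (G : sgraph n) (w : 'I_n) (phi : 'I_m -> 'I_n).
Hypothesis hG : is_contraction H u v G w phi.

Lemma contraction_neq : v != u.
Proof.
by apply: contraTneq (contr_edge hG) => ->; rewrite edge_irrefl.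
Qed.

Lemma contraction_swap : is_contraction H v u G w phi.
Proof.
case: hG => huv onto hu hv fib inj adj; split=> //; first by rewrite edge_sym.
by move=> x /fib [->|->]; [right | left].
Qed.

Lemma contraction_section : exists psi : 'I_n -> 'I_m,
  [/\ cancel psi phi, forall a, psi a != u,
      forall x, x != u -> psi (phi x) = x & psi w = v].
Proof.
have [f fP] : {f : 'I_n -> 'I_m & forall a, phi (f a) = a /\ f a != u}.
  apply: (@choice _ _ (fun a x => phi x = a /\ x != u)) => a.
  have [x xa] := contr_onto hG a.
  have [xu|xu] := eqVneq x u; last by exists x.
  exists v; split; last exact: contraction_neq.
  by rewrite (contr_v hG) -xa xu (contr_u hG).
have fw : f w = v.
  have [fw fu] := fP w; have [E|//] := contr_fibre_w hG fw.
  by rewrite E eqxx in fu.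
exists f; split=> // [a|a|x xu]; try by have [] := fP a.
have [xw|/eqP xw] := eqVneq (phi x) w.
  rewrite xw fw; have [E|->//] := contr_fibre_w hG xw.
  by rewrite E eqxx in xu.
by apply/esym/(contr_inj hG xw); have [->] := fP (phi x).
Qed.

Lemma contraction_phi_neq x : x != u -> x != v -> phi x != w.
Proof.
move=> xu xv; apply/eqP => /(contr_fibre_w hG) [E|E]; move: xu xv;
  by rewrite E eqxx.
Qed.

Lemma contraction_edge x y : x != u -> x != v -> y != u -> y != v ->
  edge G (phi x) (phi y) <-> edge H x y.
Proof.
move=> xu xv yu yv; have phix := contraction_phi_neq xu xv.
have phiy := contraction_phi_neq yu yv; split=> [/(contr_adj hG)|xy].
  move=> [_ [x' [y' [xx yy]]]].
  rewrite (contr_inj hG (x := x) (y := x') (elimN eqP phix) (esym xx)).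
  by rewrite (contr_inj hG (x := y) (y := y') (elimN eqP phiy) (esym yy)).
apply/(contr_adj hG); split; last by exists x, y.
move=> E; move: xy; rewrite (contr_inj hG (elimN eqP phix) E).
by rewrite edge_irrefl.
Qed.

Lemma contraction_edge_w y : y != u -> y != v ->
  edge G w (phi y) <-> edge H u y \/ edge H v y.
Proof.
move=> yu yv; have phiy := contraction_phi_neq yu yv; split.
  move=> /(contr_adj hG) [_ [x' [y' [xx yy]]]].
  rewrite -(contr_inj hG (x := y) (y := y') (elimN eqP phiy) (esym yy)).
  by have [->|->] := contr_fibre_w hG xx; [left | right].
move=> xy; apply/(contr_adj hG); split.
  by move=> E; rewrite -E eqxx in phiy.
by case: xy => xy; [exists u, y | exists v, y]; split=> //;
  rewrite ?(contr_u hG) ?(contr_v hG).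
Qed.

Hypothesis hcommon : forall x : 'I_m, ~ (edge H u x /\ edge H v x).

(** The condition [j != u] keeps the equation of row [u] available, both for the nullity of the
    deleted matrix and for the SNIP. *)
Lemma decontraction (R : realType) (i : 'I_n) (A : 'M[R]_n) (j : 'I_m) :
  in_S G A -> SNIP i A -> phi j = i -> j != u ->
  exists A' : 'M[R]_m,
    [/\ in_S H A', nullity_pair j A' = nullity_pair i A & SNIP j A'].
Proof.
move=> hA snipA ji ju.
have [psi [psiK psi_neq phiK psi_w]] := contraction_section.
have vu := contraction_neq.
have phiv : phi v = w := contr_v hG.
(* The neighbours of [u] other than [v]: since [psi w = v] is adjacent to [u], [w] has to be
   excluded, and so [c] vanishes at [w]. *)
pose nu a := (a != w) && edge H u (psi a).
have [s [C [K /=]]] := SNIP_perturbation w nu hA snipA.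
set c := restr_row nu w C; set B := C - _.
case=> s_gt0 [C_sym C_edge] Ki [Lu LB] robust.
have s_neq0 : s != 0 by rewrite gt_eqF.
have cw : c 0 w = 0 by rewrite mxE /nu eqxx.
have cE x : x != u -> x != v ->
    c 0 (phi x) = if edge H u x then C w (phi x) else 0.
  by move=> xu xv; rewrite mxE /nu contraction_phi_neq // phiK.
have BE a b : B a b = C a b - s * (c 0 a * c 0 b).
  by rewrite /B; move: (c) => c'; rewrite !mxE big_ord1 !mxE.
pose A' := split_mx u v psi s c B.
have A'uE y : y != u -> A' u y = c 0 (phi y) - s^-1 * (y == v)%:R.
  move=> yu; rewrite /A' (split_mxE _ psiK psi_neq phiK).
  rewrite !(split_rowE psiK psi_neq phiK psi_w).
  by rewrite eqxx (negPf yu) /=; field.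
have A'E x y : x != u -> y != u -> A' x y = C (phi x) (phi y)
    - c 0 (phi x) * (y == v)%:R - c 0 (phi y) * (x == v)%:R
    + s^-1 * (x == v)%:R * (y == v)%:R.
  move=> xu yu; rewrite /A' (split_mxE _ psiK psi_neq phiK).
  rewrite !(split_rowE psiK psi_neq phiK psi_w).
  by rewrite (negPf xu) (negPf yu) BE /=; field.
have C_symE a b : C a b = C b a by rewrite -[in LHS]C_sym mxE.
have A'_sym x y : A' x y = A' y x.
  rewrite /A' !(split_mxE _ psiK psi_neq phiK) !BE orbC.
  rewrite (C_symE (phi x)) (mulrC (c 0 (phi x))).
  by rewrite (mulrC (split_row _ _ _ _ _ 0 x)).
have A'_u y : y != u -> A' u y <> 0 <-> edge H u y.
  move=> yu; rewrite A'uE //; have [->|yv] := eqVneq y v.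
    rewrite phiv cw (contr_edge hG) mulr1 sub0r; split=> // _.
    by apply/eqP; rewrite oppr_eq0 invr_eq0.
  rewrite mulr0 subr0 cE //; case: ifP => uy; last by split.
  split=> // _; apply/C_edge; last by apply/(contraction_edge_w yu yv); left.
  by apply/eqP; rewrite eq_sym contraction_phi_neq.
(* The entry is [C w (phi y) - c 0 (phi y)]. It cancels exactly when [y] is a neighbour of [u], and
   such a [y] is not adjacent to [v] by [hcommon]. *)
have A'_v y : y != u -> y != v -> A' v y <> 0 <-> edge H v y.
  move=> yu yv; rewrite A'E // phiv cw eqxx (negPf yv) cE //.
  have wy : w <> phi y by apply/eqP; rewrite eq_sym contraction_phi_neq.
  rewrite !mulr0 !mulr1 addr0 subr0; case: ifP => uy.
    by rewrite subrr; split=> // vy; case: (hcommon (x := y)).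
  rewrite subr0; split=> [/(C_edge _ _ wy)|vy].
    by case/(contraction_edge_w yu yv) => //; rewrite uy.
  by apply/(C_edge _ _ wy)/(contraction_edge_w yu yv); right.
have A'_in : in_S H A'.
  split; first by apply/matrixP => x y; rewrite mxE A'_sym.
  move=> x y /eqP xy; have [xu|xu] := eqVneq x u.
    by rewrite xu; apply: A'_u; rewrite -xu eq_sym.
  have [yu|yu] := eqVneq y u.
    by rewrite yu A'_sym edge_sym; apply: A'_u.
  have [xv|xv] := eqVneq x v.
    by rewrite xv; apply: A'_v => //; rewrite -xv eq_sym.
  have [yv|yv] := eqVneq y v.
    by rewrite yv A'_sym edge_sym; apply: A'_v.
  rewrite A'E // (negPf xv) (negPf yv) !mulr0 !subr0 addr0.
  rewrite -(contraction_edge xu xv yu yv); apply: C_edge => E.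
  have := contr_inj hG (elimN eqP (contraction_phi_neq xu xv)) E.
  by apply/eqP.
exists A'; split=> //.
- have Lrow b : (forall k, b k -> k = i) ->
      forall k, b k -> row k (1%:M + K) = row k 1%:M.
    by move=> bi k /bi ->; rewrite linearD /= Ki addr0.
  congr (_, _).
    rewrite -(pinned_pred0 A') -(pinned_pred0 A).
    rewrite (nullity_pinned_split psiK psi_neq phiK psi_w c B s_gt0
      (b := pred0)) //.
    by rewrite -LB nullity_pinned_congr.
  rewrite -!nullity_pinned1.
  rewrite (nullity_pinned_split psiK psi_neq phiK psi_w c B s_gt0
    (b := pred1 i)).
  + by rewrite -LB nullity_pinned_congr //; apply: Lrow => k /eqP.
  + by rewrite /= eq_sym.
  + move=> a /=; rewrite -ji; apply/eqP/eqP => [<-|->]; first by rewrite psiK.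
    by rewrite phiK.
move=> X X_sym AX IX rX.
have X_symE x y : X x y = X y x by rewrite -[in LHS]X_sym mxE.
have X_diag x : X x x = 0.
  by have /matrixP/(_ x x) := IX; rewrite !mxE eqxx mul1r.
have X_off x y : A' x y <> 0 -> X x y = 0.
  move=> /eqP A0; have /matrixP/(_ x y) := AX.
  by rewrite [LHS]mxE [RHS]mxE => /eqP; rewrite mulf_eq0 (negPf A0) => /eqP.
have A'X x l : x != j -> (A' *m X) x l = 0.
  move=> xj; case: (unliftP j x) xj => [a ->|->]; last by rewrite eqxx.
  by have /matrixP/(_ a l) := rX; rewrite [LHS]mxE [RHS]mxE.
pose Q := restr_mx R psi.
have hX : split_row u v psi s c *m X = 0.
  apply: (split_mx_row_u_eq0 psiK psi_neq phiK psi_w (B := B) s_gt0) => l.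
  by apply: A'X; rewrite eq_sym.
(* The compression of [X] to the vertices other than [u], indexed by [G]; it is shown to vanish by
   the last clause of [SNIP_perturbation]. *)
pose Y := Q *m X *m Q^T.
have YE a b : Y a b = X (psi a) (psi b).
  by rewrite /Y mul_restr_trE restr_mulE.
have X_uv y : X u y = X v y - s * (c *m (Q *m X)) 0 y.
  have /matrixP/(_ 0 y) := hX.
  rewrite /split_row mulmxDl mulmxBl -!rowE -scalemxAl -mulmxA -/Q.
  by move: (c *m _) => z; rewrite !mxE => hz; lra.
have cY b : (c *m Y) 0 b = (c *m (Q *m X)) 0 (psi b).
  by rewrite /Y mulmxA mul_restr_trE.
(* An edge at [w] comes from [v], and then the entry is zero, or from [u], and then
   [X u (psi b) = 0] turns [X_uv] into [Y w b = s (c Y) b]. *)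
have Y_w b : edge G w b -> `|Y w b| <= s * `|c *m Y|.
  move=> wb; have bw : b != w.
    by apply: contraTneq wb => ->; rewrite edge_irrefl.
  have bv : psi b != v by rewrite -psi_w (inj_eq (can_inj psiK)).
  have bu := psi_neq b.
  have wbH := wb; rewrite -(psiK b) in wbH.
  rewrite YE psi_w; case/(contraction_edge_w bu bv): wbH => ub.
    have -> : X v (psi b) = s * (c *m Y) 0 b.
      have := X_uv (psi b); rewrite X_off; last by apply/A'_u.
      by rewrite cY => E; lra.
    rewrite normrM (gtr0_norm s_gt0) ler_wpM2l ?(ltW s_gt0) //.
    exact: mx_norm_entry.
  rewrite X_off ?normr0 ?mulr_ge0 ?(ltW s_gt0) //.
  by apply/A'_v.
have Y_sym : Y^T = Y by apply/matrixP => a b; rewrite mxE !YE X_symE.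
have Y0 : Y = 0.
  apply: robust => // [a|a b ab|]; first by rewrite YE X_diag.
    have [aw|aw] := eqVneq a w; first by rewrite aw Y_w // -aw.
    have [bw|bw] := eqVneq b w.
      by rewrite YE X_symE -YE bw Y_w // -bw edge_sym.
    rewrite YE X_off ?normr0 ?mulr_ge0 ?(ltW s_gt0) //.
    have neq_ab : psi a <> psi b.
      by move=> /(can_inj psiK) E; rewrite E edge_irrefl in ab.
    apply/(A'_in.2 _ _ neq_ab); rewrite -(psiK a) -(psiK b) in ab.
    apply/contraction_edge; rewrite // -psi_w (inj_eq (can_inj psiK)) //.
  apply/matrixP => a b; rewrite /Y mulmxA [LHS]mxE [RHS]mxE mul_restr_trE.
  rewrite -(split_mx_mul_ker psiK psi_neq phiK (s := s) B _ _ hX).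
  apply: A'X; apply/eqP => E; have := neq_lift i a.
  by rewrite -[lift i a]psiK E ji eqxx.
apply: (restr_split_inj psiK psi_neq phiK psi_w (s := s) (c := c)) => //.
rewrite -/Q.
have QX b a : (Q *m X) a (psi b) = 0 by rewrite -mul_restr_trE -/Y Y0 mxE.
apply/matrixP => a y; rewrite [RHS]mxE.
(* Only column [u] of [Q X] remains; by symmetry and [X_uv] it is expressed through row [w] of [Y]
   and [c Y], both zero. *)
have [->|yu] := eqVneq y u; last by rewrite -(phiK y yu) QX.
rewrite restr_mulE X_symE X_uv X_symE.
rewrite -psi_w -(restr_mulE psi X) -/Q QX -cY Y0 mulmx0 mxE mulr0 subr0 //.
Qed.

End Decontraction.

(* [phi j = i] says that j is the vertex i itself when i <> w, and that j is
   either one of u and v when i = w. *)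
Theorem lemma6p10 (R : realType) (m n : nat) (H : sgraph m) (u v : 'I_m)
  (huv : edge H u v)
  (hcommon : forall x : 'I_m, ~ (edge H u x /\ edge H v x))
  (G : sgraph n) (w : 'I_n) (phi : 'I_m -> 'I_n)
  (hG : is_contraction H u v G w phi)
  (i : 'I_n) (A : 'M[R]_n) (hA : in_S G A) (hSNIP : SNIP i A)
  (j : 'I_m) (hj : phi j = i) :
  exists A' : 'M[R]_m,
    [/\ in_S H A', nullity_pair j A' = nullity_pair i A & SNIP j A'].
Proof.
(* If the root is [u], the roles of [u] and [v] are exchanged, so that the eliminated vertex is
   never the root. *)
have [ju|ju] := eqVneq j u; last first.
  exact: (decontraction hG hcommon hA hSNIP hj ju).
apply: (decontraction (contraction_swap hG) _ hA hSNIP hj) => [x [vx ux]|].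
  exact: (hcommon x).
by rewrite ju eq_sym (contraction_neq hG).
Qed.
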